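(* If $G$ is a connected cubic graph of order $n = 14$ satisfying $\gamma(G) = 5 = \frac{5}{14}n$, then $G$ is (isomorphic to) one of the four graphs $G_{14.1}$, $G_{14.2}$, $G_{14.3}$, $P(7,2)$.
   Context: Graphs are finite, simple and undirected; the order of a graph is its number of vertices. A cubic graph is a graph in which every vertex has degree $3$. A dominating set of $G$ is a set $S\subseteq V(G)$ such that every vertex not in $S$ has a neighbor in $S$; the domination number $\gamma(G)$ is the minimum cardinality of a dominating set of $G$. The four graphs, each of order $14$ with $21$ edges, are as follows. $G_{14.1}$: vertex set $\{x_1,\dots,x_6,y_1,\dots,y_6,w,t\}$; edges $x_ix_{i+1}$ and $y_iy_{i+1}$ for $1\le i\le 5$, together with $x_1y_2,\ x_2y_1,\ x_3y_3,\ x_4y_4,\ x_5y_6,\ x_6y_5,\ x_6w,\ y_6w,\ wt,\ y_1t,\ x_1t$. $G_{14.2}$: vertex set $\{x_1,\dots,x_7,y_1,\dots,y_7\}$; edges $x_ix_{i+1}$ and $y_iy_{i+1}$ for $1\le i\le 6$, the edges $x_7x_1$ and $y_7y_1$, together with $x_1y_1,\ x_2y_2,\ x_3y_4,\ x_4y_3,\ x_5y_5,\ x_6y_7,\ x_7y_6$. $G_{14.3}$: vertex set $\{x_1,\dots,x_7,y_1,\dots,y_7\}$; edges $y_iy_{i+1}$ for $1\le i\le 6$, the edge $y_7y_1$, the edges $x_iy_i$ for $1\le i\le 7$, together with $x_1x_2,\ x_6x_7,\ x_1x_3,\ x_2x_4,\ x_3x_5,\ x_4x_6,\ x_5x_7$.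 $P(7,2)$ (generalized Petersen graph): vertex set $\{u_i, w_i : i\in \mathbb{Z}/7\mathbb{Z}\}$; edges $u_iu_{i+1}$, $u_iw_i$ and $w_iw_{i+2}$ for all $i\in\mathbb{Z}/7\mathbb{Z}$ (indices modulo $7$). *)

(* Defs.v *)
From mathcomp Require Import all_boot.

Set Implicit Arguments.
Unset Strict Implicit.
Unset Printing Implicit Defensive.

Record sgraph := SGraph {
  vertex :> finType;
  adj : rel vertex;
  adj_sym : symmetric adj;
  adj_irrefl : irreflexive adj
}.

Definition connected (G : sgraph) : Prop :=
  forall u v : G, connect (@adj G) u v.

Definition cubic (G : sgraph) : Prop :=
  forall v : G, #|[set u | adj v u]| = 3.

Definition dominating (G : sgraph) (S : {set G}) : bool :=
  [forall v, (v \notin S) ==> [exists u in S, adj v u]].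

(* The default element [set: G] is always dominating, so this is the minimum
   over all dominating sets. *)
Definition domination_number (G : sgraph) : nat :=
  #|[arg min_(S < [set: G] | dominating S) #|S|]|.

Definition isomorphic (G H : sgraph) : Prop :=
  exists f : G -> H, bijective f /\ forall u v, adj (f u) (f v) = adj u v.

(* The listed pairs are unordered edges; loops in s would be discarded. *)
Section OfEdges.
Variables (n : nat) (s : seq (nat * nat)).

Definition edges_adj : rel 'I_n :=
  [rel i j : 'I_n | (i != j) &&
    (((i : nat, j : nat) \in s) || ((j : nat, i : nat) \in s))].

Lemma edges_adj_sym : symmetric edges_adj.
Proof. by move=> i j; rewrite /edges_adj /= eq_sym orbC. Qed.

Lemma edges_adj_irrefl : irreflexive edges_adj.
Proof. by move=> i; rewrite /edges_adj /= eqxx. Qed.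

Definition graph_of_edges : sgraph := SGraph edges_adj_sym edges_adj_irrefl.
End OfEdges.

(* x_i is i - 1 and y_i is i + 5 (1 <= i <= 6), w is 12 and t is 13. *)
Definition G14_1 : sgraph :=
  let x i := i.-1 in
  let y i := 6 + i.-1 in
  let w := 12 in
  let t := 13 in
  graph_of_edges 14
    ([seq (x i, x i.+1) | i <- iota 1 5] ++
     [seq (y i, y i.+1) | i <- iota 1 5] ++
     [:: (x 1, y 2); (x 2, y 1); (x 3, y 3); (x 4, y 4); (x 5, y 6);
         (x 6, y 5); (x 6, w); (y 6, w); (w, t); (y 1, t); (x 1, t)]).

(* x_i is i - 1 and y_i is i + 6 (1 <= i <= 7), here and in G14_3. *)
Definition G14_2 : sgraph :=
  let x i := i.-1 in
  let y i := 7 + i.-1 in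
  graph_of_edges 14
    ([seq (x i, x i.+1) | i <- iota 1 6] ++
     [seq (y i, y i.+1) | i <- iota 1 6] ++
     [:: (x 7, x 1); (y 7, y 1);
         (x 1, y 1); (x 2, y 2); (x 3, y 4); (x 4, y 3); (x 5, y 5);
         (x 6, y 7); (x 7, y 6)]).

Definition G14_3 : sgraph :=
  let x i := i.-1 in
  let y i := 7 + i.-1 in
  graph_of_edges 14
    ([seq (y i, y i.+1) | i <- iota 1 6] ++
     [:: (y 7, y 1)] ++
     [seq (x i, y i) | i <- iota 1 7] ++
     [:: (x 1, x 2); (x 6, x 7); (x 1, x 3); (x 2, x 4); (x 3, x 5);
         (x 4, x 6); (x 5, x 7)]).

(* u_i is i mod 7 and w_i is 7 + (i mod 7). *)
Definition P7_2 : sgraph :=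
  let u i := i %% 7 in
  let w i := 7 + i %% 7 in
  graph_of_edges 14
    ([seq (u i, u i.+1) | i <- iota 0 7] ++
     [seq (u i, w i) | i <- iota 0 7] ++
     [seq (w i, w i.+2) | i <- iota 0 7]).

(* Main.v *)
Require Import Defs.
From mathcomp Require Import all_boot.

Set Implicit Arguments.
Unset Strict Implicit.
Unset Printing Implicit Defensive.

(** The four graphs are found by an exhaustive search that is carried out inside
    the logic, by the boolean function [search], and whose soundness is the
    lemma [search_sound].

    The vertices of G receive labels 0, ..., 13, and a symmetric bit matrix
    records the edges between labels that are known so far. A branch of the
    search picks a label v of degree less than 3 and tries every label as the
    next neighbour of v. Since G is cubic, one of the attempts describes G.
    A branch is closed as soon as four known closed neighbourhoods cover
    everything, because gamma(G) = 5. When the matrix is complete, either it is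
    isomorphic to one of the four graphs or it has a closed proper set of
    labels, against connectedness.

    What makes the search small is its starting point. Four closed
    neighbourhoods contain 16 vertices with multiplicity, only two more than the
    order of G, so a triple of vertices whose closed neighbourhoods overlap little
    leaves hardly any freedom. Let M be the largest size of a union of three
    closed neighbourhoods. There are three cases.

    - M = 12: three disjoint closed neighbourhoods. Only two vertices are left
      over, and no vertex dominates both of them ([target_of_disjoint_triple]).
    - M = 11: two of the three vertices have exactly one common neighbour and
      there is no further overlap ([target_of_linked_triple]).
    - M < 11: the search starts from two vertices at distance at least 3, which
      exist because a ball of radius 2 has at most 10 elements
      ([target_of_small_unions]).

    In the last two cases the maximality of M closes many further branches
    ([spread]).

    Most of the remaining redundancy comes from relabelling. Two labels are twins
    when exchanging them does not change the matrix. If both could be the next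
    neighbour of v, then only the first has to be tried: a labelling that
    realizes the second choice becomes one that realizes the first after the
    exchange ([represents_swap]). *)

(** * Bit vectors and partially known graphs *)

(** This is [has], spelled with [if] because [vm_compute] evaluates both
    arguments of [||]: after a success the remaining elements must not be
    visited. The functions below use [if] for the same reason. *)
Fixpoint some T (p : pred T) (s : seq T) : bool :=
  if s is x :: s' then if p x then true else some p s' else false.

Lemma someE T (p : pred T) s : some p s = has p s.
Proof. by elim: s => //= x s <-. Qed.
Arguments some : simpl never.

Notation bits := (seq bool).

Fixpoint union (a b : bits) : bits :=
  match a, b with
  | x :: a', y :: b' => (if x then true else y) :: union a' b'
  | [::], _ => b
  | _, [::] => a
  end.

Fixpoint minus (a b : bits) : bits :=
  match a, b with
  | x :: a', y :: b' => (if y then false else x) :: minus a' b'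
  | _, _ => a
  end.

Definition labels : seq nat := iota 0 14.

Definition set_bit i (r : bits) : bits := set_nth false r i true.

Notation matrix := (seq bits).
Definition row (A : matrix) i : bits := nth [::] A i.
Definition known (A : matrix) i j : bool := nth false (row A i) j.
Definition add_edge (A : matrix) u v : matrix :=
  set_nth [::] (set_nth [::] A u (set_bit v (row A u))) v (set_bit u (row A v)).

(** A row is the known part of a closed neighbourhood, so it contains the
    diagonal bit and is complete when it has four bits. *)
Definition full (A : matrix) v : bool := 3 < count id (row A v).

(** * The search *)

(** Some row has to contain the first bit of [rest]. By symmetry of the matrix
    the rows to be tried are those selected by the row of that bit. The test on
    [count] discards what [k] sets of size at most 4 cannot cover. *)
Fixpoint covers k (A : matrix) (rest : bits) : bool :=
  if count id rest <= 4 * k then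
    if k is k'.+1 then
      some (fun r => covers k' A (minus rest r)) (mask (head [::] (mask rest A)) A)
    else ~~ has id rest
  else false.

(** Testing covers that use the row of [v] suffices, since it is done for both
    ends [v] of each new edge: no other cover can have appeared. *)
Definition dominated (A : matrix) v : bool :=
  covers 3 A (minus (nseq 14 true) (row A v)).

(** Three known closed neighbourhoods have a union of size at least [m]. The
    inner test looks for a third row only if two rows leave at most 4 to add. *)
Definition spread m (A : matrix) v : bool :=
  some (fun r => let s := union (row A v) r in
    if m <= 4 + count id s then some (fun r' => m <= count id (union s r')) A else false) A.

Definition twins (A : matrix) u w : bool :=
  set_bit w (set_bit u (row A u)) == set_bit u (set_bit w (row A w)).

(** The labels of [us] that have to be tried as next neighbour of [v]; [kept]
    holds those already retained, whose twins are redundant. *)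
Fixpoint candidates (A : matrix) v (kept us : seq nat) : seq nat :=
  if us is u :: us' then
    if (if known A v u then true else if full A u then true else some (twins A u) kept)
    then candidates A v kept us' else u :: candidates A v (u :: kept) us'
  else [::].

Definition id_matrix : matrix := mkseq (fun i => mkseq (fun j => eqn i j) 14) 14.
Definition start (es : seq (nat * nat)) : matrix :=
  foldl (fun A e => add_edge A e.1 e.2) id_matrix es.

(** Unification reads the edge lists off the four graphs. *)
Definition G14_1_edges : {s | G14_1 = graph_of_edges 14 s} := exist _ _ erefl.
Definition G14_2_edges : {s | G14_2 = graph_of_edges 14 s} := exist _ _ erefl.
Definition G14_3_edges : {s | G14_3 = graph_of_edges 14 s} := exist _ _ erefl.
Definition P7_2_edges : {s | P7_2 = graph_of_edges 14 s} := exist _ _ erefl.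
Definition targets : seq (seq (nat * nat)) :=
  [:: sval G14_1_edges; sval G14_2_edges; sval G14_3_edges; sval P7_2_edges].

Definition frontier (A : matrix) (o : seq nat) : seq nat :=
  [seq j <- labels | (j \notin o) && has (fun i => known A i j) o].
Arguments frontier : simpl never.

(** The labels are listed in breadth-first order, so that [matches] below almost
    always meets a label with a neighbour whose image is already fixed. *)
Fixpoint component n (A : matrix) (o : seq nat) : seq nat :=
  if n isn't n'.+1 then o else
  if frontier A o is j :: js then component n' A (o ++ j :: js) else o.

(** Backtracking search for an embedding of [A] into [B]; [paired] lists the
    labels treated so far with their images. *)
Fixpoint matches (A B : matrix) (paired : seq (nat * nat)) (todo : seq nat) : bool :=
  if todo isn't v :: todo' then true else
  some (fun c =>
     if all (fun p => (c != p.2) && (known A v p.1 == known B c p.2)) paired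
     then matches A B ((v, c) :: paired) todo' else false) labels.

Definition leaf (A : matrix) : bool :=
  let o := component 14 A [:: 0] in
  if ~~ all (full A) labels then false else
  if all (fun j => j \in o) labels
  then some (fun s => matches A (start s) [::] o) targets
  else frontier A o == [::].

(** The neighbours of [v] are added in increasing order of their labels:
    every label below [lb] that is adjacent to [v] is known to be so. *)
Definition extensions m (rec : matrix -> nat -> nat -> bool) (A : matrix) v lb : bool :=
  all (fun u => let A' := add_edge A v u in
    if some (spread m A') [:: v; u] then true else
    if some (dominated A') [:: v; u] then true else rec A' v u.+1)
  (candidates A v [::] (iota lb (14 - lb))).

(** The labels are completed in the given [order]; each level of the recursion
    on [n] adds one edge, until the matrix is complete. *)
Fixpoint search m order n (A : matrix) v lb : bool :=
  if n isn't n'.+1 then false else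
  if full A v then
    if [seq w <- order | ~~ full A w] is w :: _
    then extensions m (search m order n') A w 0 else leaf A
  else extensions m (search m order n') A v lb.

(** * Elementary properties of the data *)

Lemma mem_labels i : (i \in labels) = (i < 14).
Proof. by rewrite mem_iota. Qed.

Lemma nth_union a b i : nth false (union a b) i = nth false a i || nth false b i.
Proof.
by elim: a b i => [|x a IH] [|y b] [|i] //=; rewrite ?nth_nil ?orbF.
Qed.

Lemma nth_minus a b i : nth false (minus a b) i = nth false a i && ~~ nth false b i.
Proof.
elim: a b i => [|x a IH] [|y b] [|i] //=; rewrite ?nth_nil ?andbT //.
by case: x y => [] [].
Qed.

Lemma nth_set_bit i r j : nth false (set_bit i r) j = (j == i) || nth false r j.
Proof. by rewrite nth_set_nth /=; case: eqP. Qed.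

Lemma known_add_edge A u v i j :
  known (add_edge A u v) i j =
    [|| known A i j, (i == u) && (j == v) | (i == v) && (j == u)].
Proof.
rewrite /known /add_edge /row nth_set_nth /=.
have [->|ne_iv] := eqVneq i v.
  rewrite nth_set_bit; have [->|ne_vu] := eqVneq v u => /=; last by rewrite orbC.
  by case: (j == u) (nth _ _ _) => [] [].
rewrite nth_set_nth /=; have [->|ne_iu] := eqVneq i u; last by rewrite !orbF.
by rewrite nth_set_bit orbF orbC.
Qed.

Lemma known_start es i j :
  known (start es) i j =
    [|| (i == j) && (i < 14), (i, j) \in es | (j, i) \in es].
Proof.
have known_id : known id_matrix i j = (i == j) && (i < 14).
  rewrite /known /row /id_matrix; have [lt_i|ge_i] := ltnP i 14; last first.
    by rewrite [nth [::] _ i]nth_default ?size_mkseq // nth_nil andbF.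
  rewrite nth_mkseq // andbT; have [lt_j|ge_j] := ltnP j 14.
    by rewrite nth_mkseq.
  rewrite nth_default ?size_mkseq //; case: eqP => // eq_ij.
  by rewrite eq_ij ltnNge ge_j in lt_i.
rewrite -known_id /start; elim: es id_matrix {known_id} => [|[u v] es IH] A /=.
  by rewrite !orbF.
rewrite {}IH known_add_edge /= !inE !xpair_eqE.
rewrite [(j == u) && _]andbC -!orbA; congr (_ || (_ || _)).
by rewrite orbCA.
Qed.

Lemma count_bits (r : bits) :
  count id r = size [seq i <- iota 0 (size r) | nth false r i].
Proof. by rewrite -{1}(mkseq_nth false r) count_map size_filter. Qed.

(** * Labellings of a cubic graph of order 14 *)

Definition closed_nbhd (G : sgraph) (v : G) : {set G} :=
  [set u | (u == v) || adj v u].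

Definition union3 (G : sgraph) (a b c : G) : {set G} :=
  closed_nbhd a :|: closed_nbhd b :|: closed_nbhd c.

Section Labellings.
Variables (G : sgraph) (m : nat).
Hypothesis G_cubic : cubic G.
Hypothesis G_order : #|G| = 14.
Hypothesis no_dominating4 : forall S : {set G}, dominating S -> 4 < #|S|.
Hypothesis small_unions : forall a b c : G, #|union3 a b c| < m.

Lemma mem_closed_nbhd (u v : G) : (u \in closed_nbhd v) = (u == v) || adj v u.
Proof. by rewrite inE. Qed.

Lemma card_closed_nbhd (v : G) : #|closed_nbhd v| = 4.
Proof.
have -> : closed_nbhd v = v |: [set u | adj v u] by apply/setP => u; rewrite !inE.
by rewrite cardsU1 inE adj_irrefl G_cubic.
Qed.

Definition labelling (f : nat -> G) : Prop := {in gtn 14 &, injective f}.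

(** [A] records only edges of G, seen through the labelling [f]. *)
Record represents (f : nat -> G) (A : matrix) : Prop := Represents {
  known_sym : symmetric (known A);
  known_diag : forall i, i < 14 -> known A i i;
  known_nbhd : forall i j, known A i j -> (i < 14) && (f j \in closed_nbhd (f i))
}.

Section Labelled.
Variable f : nat -> G.
Hypothesis f_labelling : labelling f.

Lemma label_of (v : G) : exists2 i, i < 14 & f i = v.
Proof.
have f_uniq : uniq [seq f i | i <- labels].
  rewrite map_inj_in_uniq ?iota_uniq // => i j.
  by rewrite !mem_labels => lt_i lt_j; apply: f_labelling.
have all_f : [set u in [seq f i | i <- labels]] = setT.
  apply/eqP; rewrite eqEcard subsetT cardsT G_order cardsE.
  by rewrite (card_uniqP f_uniq) size_map size_iota.
have: v \in [set u in [seq f i | i <- labels]] by rewrite all_f.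
by rewrite inE => /mapP[i]; rewrite mem_labels => lt_i ->; exists i.
Qed.

Lemma count_bits_card r (X : {set G}) :
    (forall j, nth false r j -> (j < 14) && (f j \in X)) -> count id r <= #|X|.
Proof.
move=> r_X; rewrite count_bits -(size_map f).
set s := filter _ _; have s_r j : j \in s -> nth false r j.
  by rewrite mem_filter => /andP[].
have /card_uniqP <- : uniq (map f s).
  rewrite map_inj_in_uniq ?filter_uniq ?iota_uniq // => i j.
  move=> /s_r/r_X/andP[lt_i _] /s_r/r_X/andP[lt_j _].
  exact: f_labelling.
apply/subset_leq_card/subsetP => _ /mapP[i /s_r/r_X/andP[_ Xi] ->] //.
Qed.

Variable A : matrix.
Hypothesis A_repr : represents f A.

Lemma known_lt i j : known A i j -> (i < 14) && (j < 14).
Proof.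
move=> Aij; have /andP[-> _] := known_nbhd A_repr Aij.
by rewrite (known_sym A_repr) in Aij; have /andP[-> _] := known_nbhd A_repr Aij.
Qed.

Lemma known_adj i j : known A i j -> i != j -> adj (f i) (f j).
Proof.
move=> Aij ne_ij; have /andP[lt_i lt_j] := known_lt Aij.
have /andP[_] := known_nbhd A_repr Aij; rewrite inE => /predU1P[] //.
by move/f_labelling=> eq_ij; rewrite eq_ij ?eqxx in ne_ij.
Qed.

(** Otherwise the four labels of the row of [v] would inject into the closed
    neighbourhood of [f v] without [f j], which has three elements. *)
Lemma full_known v j :
  full A v -> v < 14 -> j < 14 -> adj (f v) (f j) -> known A v j.
Proof.
move=> v_full lt_v lt_j vj; apply/negPn/negP => nAvj.
have: count id (row A v) <= #|closed_nbhd (f v) :\ f j|.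
  apply: count_bits_card => k Avk; have /andP[_ lt_k] := known_lt Avk.
  have /andP[_ nbh] := known_nbhd A_repr Avk; rewrite lt_k 2!inE nbh andbT.
  apply: contra nAvj => /eqP/f_labelling => <- //.
rewrite leqNgt (leq_trans _ v_full) // ltnS -ltnS.
rewrite (_ : 4 = #|closed_nbhd (f v)|); last by rewrite card_closed_nbhd.
by rewrite [X in _ < X](cardsD1 (f j)) mem_closed_nbhd vj orbT.
Qed.

Lemma missing_neighbour v :
  v < 14 -> ~~ full A v -> exists u, [&& u < 14, adj (f v) (f u) & ~~ known A v u].
Proof.
move=> lt_v v_short.
have: ~~ (closed_nbhd (f v) \subset
   [set u in [seq f i | i <- iota 0 (size (row A v)) & nth false (row A v) i]]).
  apply: contra v_short => /subset_leq_card; rewrite card_closed_nbhd cardsE => le4.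
  by rewrite /full count_bits -(size_map f) (leq_trans le4) ?card_size.
case/subsetPn => w; have [u lt_u <-] := label_of w.
rewrite mem_closed_nbhd inE => vu /negP u_new.
have nAvu : ~~ known A v u.
  apply/negP => Avu; apply: u_new; apply: map_f.
  rewrite mem_filter mem_iota; apply/andP; split=> //=.
  by rewrite ltnNge; apply/negP => ge_u; rewrite /known nth_default in Avu.
exists u; rewrite lt_u nAvu andbT /=.
case/predU1P: vu => // /f_labelling eq_uv.
by rewrite eq_uv ?(known_diag A_repr) in nAvu.
Qed.

(** Distinct labels name distinct vertices, so the number of known elements of a
    union is a lower bound for its size in G. *)
Lemma spreadF v : spread m A v = false.
Proof.
rewrite /spread someE; apply/hasP => -[r /(nthP [::])[i _ def_r]].
case: ifP => // _; rewrite someE => /hasP[r' /(nthP [::])[j _ def_r']].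
rewrite leqNgt => /negP; apply; apply: leq_ltn_trans (small_unions (f v) (f i) (f j)).
apply: count_bits_card => k; rewrite !nth_union -def_r -def_r'.
rewrite 2!in_setU => /orP[/orP[]|] Ak;
  have /andP[_ nbh] := known_nbhd A_repr Ak; rewrite nbh ?orbT andbT;
  by have /andP[] := known_lt Ak.
Qed.

Lemma covers_sound k rest : covers k A rest ->
  exists s, size s <= k /\
    forall i, nth false rest i -> exists2 u, u \in s & known A u i.
Proof.
elim: k rest => [|k IH] rest /=; case: ifP => // _.
  move=> /hasPn no_rest; exists [::]; split=> // i rest_i.
  have lt_i : i < size rest by rewrite ltnNge; apply: contraL rest_i => /(nth_default _) ->.
  by have := no_rest _ (mem_nth false lt_i); rewrite rest_i.
rewrite someE => /hasP[r /mem_mask/(nthP [::])[u _ def_r]] /IH[s [le_s cov_s]].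
exists (u :: s); split=> // i rest_i; have [ui|nui] := boolP (known A u i).
  by exists u; rewrite ?mem_head.
have [|w sw wi] := cov_s i; first by rewrite nth_minus rest_i -def_r.
by exists w; rewrite // inE sw orbT.
Qed.

Lemma dominatedF v : dominated A v = false.
Proof.
apply/negP => /covers_sound[s [le_s cov_s]].
suff /no_dominating4 : dominating [set x in [seq f i | i <- v :: s]].
  by rewrite ltnNge cardsE (leq_trans (card_size _)) // size_map.
apply/forallP => x; apply/implyP; have [i lt_i <-] := label_of x.
have [u us Aui] : exists2 u, u \in v :: s & known A u i.
  have [vi|nvi] := boolP (known A v i); first by exists v; rewrite ?mem_head.
  have [|w sw wi] := cov_s i; first by rewrite nth_minus nth_nseq lt_i.
  by exists w; rewrite // inE sw orbT.
rewrite inE => /negP i_out; apply/existsP; exists (f u); rewrite inE map_f //=.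
have [eq_ui|] := eqVneq u i; first by case: i_out; rewrite -eq_ui map_f.
by rewrite adj_sym; apply: known_adj.
Qed.

End Labelled.

Lemma twins_known A u w j : twins A u w -> j != u -> j != w ->
  known A u j = known A w j.
Proof.
move=> /eqP eq_rows ne_ju ne_jw; move/(congr1 (fun r => nth false r j)): eq_rows.
by rewrite !nth_set_bit (negPf ne_ju) (negPf ne_jw).
Qed.

Definition swap (u w i : nat) := if i == w then u else if i == u then w else i.

(** Exchanging twins is an automorphism of the matrix, so composing a labelling
    with the exchange represents the same matrix. *)
Lemma represents_swap f A u w : labelling f -> represents f A -> twins A u w ->
  u < 14 -> w < 14 ->
  labelling (f \o swap u w) /\ represents (f \o swap u w) A.
Proof.
move=> f_lab A_repr uw_twins lt_u lt_w.
have swap_lt i : i < 14 -> swap u w i < 14 by rewrite /swap; do 2!case: ifP => // _.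
have swap_inj : injective (swap u w).
  move=> i j; rewrite /swap; do 2!case: eqP => [->|?]; do 2?case: eqP => [->|?] //; congruence.
split=> [i j lt_i lt_j|].
  by move/f_lab => /(_ (swap_lt _ lt_i) (swap_lt _ lt_j))/swap_inj.
have A_sym := known_sym A_repr; have A_diag := known_diag A_repr.
split=> // i j Aij.
suff /(known_nbhd A_repr)/andP[_ nbh] : known A (swap u w i) (swap u w j).
  by have /andP[-> _] := known_lt A_repr Aij.
have tw k : k != u -> k != w -> known A u k = known A w k by apply: twins_known.
rewrite /swap; have [eq_iw|ne_iw] := eqVneq i w; have [eq_jw|ne_jw] := eqVneq j w;
  rewrite ?A_diag //; have [eq_iu|ne_iu] := eqVneq i u;
  have [eq_ju|ne_ju] := eqVneq j u; subst => //; rewrite ?A_diag //.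
- by rewrite A_sym.
- by rewrite tw.
- by rewrite A_sym.
- by rewrite A_sym tw // A_sym.
- by rewrite -tw.
- by rewrite A_sym -tw // A_sym.
Qed.

Lemma represents_add_edge f A u v : u < 14 -> v < 14 -> adj (f u) (f v) ->
  represents f A -> represents f (add_edge A u v).
Proof.
move=> lt_u lt_v uv A_repr; split=> [i j|i lt_i|i j]; rewrite !known_add_edge.
- rewrite (known_sym A_repr); congr (_ || _).
  by rewrite orbC ![(i == _) && _]andbC.
- by rewrite (known_diag A_repr).
case/or3P=> [/(known_nbhd A_repr) //|/andP[/eqP-> /eqP->]|/andP[/eqP-> /eqP->]].
  by rewrite lt_u inE uv orbT.
by rewrite lt_v inE adj_sym uv orbT.
Qed.

(** The retained twin comes earlier in the list, so an exchange with it does not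
    disturb the labels that are already settled. *)
Lemma candidatesP A v (kept : seq nat) a n u : (forall w, w \in kept -> w < a) ->
    a <= u < a + n -> ~~ known A v u -> ~~ full A u ->
  u \in candidates A v kept (iota a n) \/
  exists2 w, (w < u) && twins A u w & (w \in kept) || (w \in candidates A v kept (iota a n)).
Proof.
elim: n a kept => [|n IH] a kept kept_lt.
  by rewrite addn0; case: ltngtP.
rewrite addnS /= => /andP[le_au lt_u] nAvu nfu.
have [eq_au|ne_au] := eqVneq a u.
  subst a; rewrite (negPf nAvu) (negPf nfu) someE; case: ifP => [|_]; last first.
    by left; rewrite mem_head.
  case/hasP => w kw tw; right; exists w; first by rewrite kept_lt.
  by rewrite kw.
have lt_au : a.+1 <= u < a.+1 + n by rewrite ltn_neqAle ne_au le_au addSn.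
case: ifP => _.
  apply: IH => // w /kept_lt; exact: ltnW.
have kept_lt' w : w \in a :: kept -> w < a.+1.
  by rewrite inE => /predU1P[->|/kept_lt/ltnW].
case: (IH a.+1 _ kept_lt' lt_au nAvu nfu) => [u_in|[w lt_w w_in]].
  by left; rewrite inE u_in orbT.
right; exists w; rewrite // !inE in w_in *.
by case/orP: w_in => [/orP[]|] ->; rewrite ?orbT.
Qed.

Lemma candidates_unknown A v kept us u :
  u \in candidates A v kept us -> ~~ known A v u.
Proof.
elim: us kept => //= a us IH kept; case: ifP => [_ /IH //|].
case: ifP => // /negbT nAva _; rewrite inE => /predU1P[->|/IH] //.
Qed.

(** * Complete matrices *)

Hypothesis G_connected : connected G.

Lemma component_sub n A o : {subset o <= component n A o}.
Proof.
elim: n o => [|n IH] o i oi //=; case: (frontier A o) => // j js.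
by apply: IH; rewrite mem_cat oi.
Qed.

(** A set of labels without frontier is a union of components of G. *)
Lemma closed_component f A (o : seq nat) : labelling f -> represents f A -> 0 \in o ->
    (forall i, i < 14 -> full A i) -> frontier A o = [::] ->
  all (fun j => j \in o) labels.
Proof.
move=> f_lab A_repr o0 A_full o_closed; apply/allP => j; rewrite mem_labels => lt_j.
pose reached := [pred x | x \in [seq f i | i <- o & i < 14]].
have reachedE i : i < 14 -> (f i \in reached) = (i \in o).
  move=> lt_i; apply/mapP/idP => [[k]|oi]; last by exists i; rewrite // mem_filter lt_i.
  by rewrite mem_filter => /andP[lt_k ok] /f_lab ->.
have reached_closed : closed (@adj G) reached.
  apply: (intro_closed (sym_connect_sym (@adj_sym G))) => x y xy.
  have [[i lt_i eq_i] [k lt_k eq_k]] := (label_of f_lab x, label_of f_lab y).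
  subst x y; rewrite !reachedE // => oi.
  apply/negPn/negP => no_k; suff: k \in frontier A o by rewrite o_closed.
  rewrite mem_filter mem_labels no_k lt_k /= andbT; apply/hasP; exists i => //.
  exact: (full_known f_lab A_repr (A_full _ lt_i)).
by rewrite -reachedE // -(closed_connect reached_closed (G_connected (f 0) (f j))) reachedE.
Qed.

Definition compatible (A B : matrix) (p p' : nat * nat) :=
  (p.2 != p'.2) && (known A p.1 p'.1 == known B p.2 p'.2).

Lemma matchesP A B paired todo : matches A B paired todo ->
    pairwise (compatible A B) paired -> all (fun p => p.2 < 14) paired ->
  exists d, [/\ pairwise (compatible A B) d, all (fun p => p.2 < 14) d
    & {subset todo <= unzip1 d} /\ {subset paired <= d}].
Proof.
elim: todo paired => [|v todo IH] paired.
  by move=> _ paired_ok paired_lt; exists paired; split=> //; split=> // i; rewrite in_nil.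
rewrite /= someE => /hasP[c]; rewrite mem_labels => lt_c.
case: ifP => // all_c /IH sub paired_ok paired_lt.
have [||d [d_ok d_lt [todo_d paired_d]]] := sub.
- by rewrite /= paired_ok andbT.
- by rewrite /= lt_c.
exists d; split=> //; split=> [i|p p_in]; last by apply: paired_d; rewrite inE p_in orbT.
rewrite inE => /predU1P[->|/todo_d //].
by apply: (map_f fst (paired_d (v, c) _)); rewrite mem_head.
Qed.

Lemma start_sym es : symmetric (known (start es)).
Proof.
by move=> i j; rewrite !known_start [i == j]eq_sym; case: eqP => [->|_] //=; rewrite orbC.
Qed.

Lemma matches_isomorphic f A es (o : seq nat) : labelling f -> represents f A ->
    (forall i, i < 14 -> full A i) -> all (fun j => j \in o) labels ->
  matches A (start es) [::] o -> isomorphic G (graph_of_edges 14 es).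
Proof.
move=> f_lab A_repr A_full /allP o_all /matchesP[//|//|d [d_ok d_lt [o_d _]]].
have d_all i : i < 14 -> i \in unzip1 d by move=> lt_i; apply/o_d/o_all; rewrite mem_labels.
(* The association list d mentions every label; q is the map that it encodes, and
   the first entry for a label decides. *)
pose pair_of i := nth (0, 0) d (index i (unzip1 d)).
have in_d i : i < 14 -> index i (unzip1 d) < size d.
  by move=> lt_i; rewrite -(size_map fst) index_mem d_all.
have fst_pair i : i < 14 -> (pair_of i).1 = i.
  by move=> lt_i; rewrite /pair_of -(nth_map _ 0) ?in_d // nth_index ?d_all.
pose q i := (pair_of i).2.
have q_lt i : i < 14 -> q i < 14.
  by move=> lt_i; apply: (allP d_lt); rewrite mem_nth ?in_d.
have q_ok i j : i < 14 -> j < 14 -> i != j ->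
    (q i != q j) && (known A i j == known (start es) (q i) (q j)).
  move=> lt_i lt_j; wlog lt_ij: i j lt_i lt_j / index i (unzip1 d) < index j (unzip1 d).
    move=> IH ne_ij; case: (ltngtP (index i (unzip1 d)) (index j (unzip1 d))).
    - by move=> lt_ij; apply: IH.
    - move=> lt_ji; rewrite (known_sym A_repr) start_sym [q i == _]eq_sym.
      by apply: IH; rewrite // eq_sym.
    move/(congr1 (nth 0 (unzip1 d))); rewrite !nth_index ?d_all // => eq_ij.
    by rewrite eq_ij eqxx in ne_ij.
  move=> _; have /(pairwiseP (0, 0)) := d_ok.
  move=> /(_ _ _ (in_d _ lt_i) (in_d _ lt_j) lt_ij); rewrite /compatible.
  by rewrite -!/(pair_of _) !fst_pair.
have /fin_all_exists[lab labP] : forall x : G, exists i, i < 14 /\ f i = x.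
  by move=> x; have [i] := label_of f_lab x; exists i.
have lab_lt x : lab x < 14 by case: (labP x).
have lab_ne x y : x != y -> lab x != lab y.
  by apply: contraNneq => eq_lab; rewrite -(proj2 (labP x)) -(proj2 (labP y)) eq_lab.
pose g x : graph_of_edges 14 es := inord (q (lab x)) : 'I_14.
have gE x : (g x : 'I_14) = q (lab x) :> nat by rewrite /g inordK ?q_lt.
exists g; split=> [|x y].
  apply: inj_card_bij => [x y eq_g|]; last by rewrite card_ord G_order.
  apply/eqP/negPn/negP => /lab_ne/(q_ok _ _ (lab_lt x) (lab_lt y))/andP[].
  by rewrite -!gE eq_g eqxx.
have [->|ne_xy] := eqVneq x y; first by rewrite !adj_irrefl.
have /andP[ne_q /eqP knownE] := q_ok _ _ (lab_lt x) (lab_lt y) (lab_ne _ _ ne_xy).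
rewrite /= /edges_adj /= -val_eqE /= !gE ne_q /=.
move: knownE; rewrite known_start (negPf ne_q) /= => <-.
rewrite -{2}(proj2 (labP x)) -{2}(proj2 (labP y)).
apply/idP/idP => [/(known_adj f_lab A_repr)|/(full_known f_lab A_repr)]; apply=> //.
- exact: lab_ne.
- exact: A_full.
Qed.

Definition is_target : Prop :=
  exists2 es, es \in targets & isomorphic G (graph_of_edges 14 es).

Lemma leaf_sound f A : labelling f -> represents f A -> leaf A -> is_target.
Proof.
move=> f_lab A_repr; rewrite /leaf; case: ifP => // /negbFE/allP all_full.
have A_full i : i < 14 -> full A i by move=> lt_i; apply: all_full; rewrite mem_labels.
case: ifP => [o_all|o_some]; last first.
  move/eqP/(closed_component f_lab A_repr _ A_full) => o_all.
  by rewrite o_all ?component_sub in o_some.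
rewrite someE => /hasP[es es_t ok]; exists es => //.
exact: (matches_isomorphic f_lab A_repr A_full o_all).
Qed.

(** * Soundness of the search *)

(** The induction on [n] is for all labellings at once. At the vertex that is
    being completed, take the missing neighbour [u] with the smallest label. If
    it is a candidate, its branch applies to [f]. If not, it has a retained
    twin [k], and the branch of [k] applies to [f] composed with the exchange of
    [u] and [k]; since [k < u], the exchange fixes all labels below [k]. *)
Lemma search_sound order n f A v lb : all (gtn 14) order ->
    labelling f -> represents f A -> v < 14 ->
    (forall j, j < lb -> adj (f v) (f j) -> known A v j) -> search m order n A v lb ->
  is_target.
Proof.
move=> /allP order_lt; elim: n f A v lb => //= n IH f A v lb f_lab A_repr lt_v v_lb.
have extendP w b : w < 14 -> ~~ full A w ->
    (forall j, j < b -> adj (f w) (f j) -> known A w j) ->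
    extensions m (search m order n) A w b -> is_target.
  move=> lt_w w_short w_b /allP explored.
  case: (ex_minnP (missing_neighbour f_lab A_repr lt_w w_short)) => u.
  move=> /and3P[lt_u wu nAwu] u_min.
  have w_u j : j < u -> adj (f w) (f j) -> known A w j.
    move=> lt_ju wj; apply/negPn/negP => nAwj.
    by have := u_min j; rewrite wj nAwj (ltn_trans lt_ju lt_u) leqNgt lt_ju => /(_ isT).
  have le_bu : b <= u by rewrite leqNgt; apply: contra nAwu => /w_b; apply.
  have branch f' k : labelling f' -> represents f' A ->
      k \in candidates A w [::] (iota b (14 - b)) ->
      k < 14 -> adj (f' w) (f' k) -> (forall j, j < k -> adj (f' w) (f' j) -> known A w j) ->
      is_target.
    move=> f'_lab A_repr' k_cand lt_k wk w_k.
    have A'_repr := represents_add_edge lt_w lt_k wk A_repr'.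
    have := explored k k_cand; rewrite /= !someE /= !(spreadF f'_lab A'_repr).
    rewrite !(dominatedF f'_lab A'_repr) /=; apply: (IH f') => // j.
    rewrite ltnS leq_eqVlt known_add_edge => /predU1P[->|lt_j] wj.
      by rewrite !eqxx orbT.
    by rewrite w_k.
  have u_full : ~~ full A u.
    apply/negP => /(full_known f_lab A_repr)/(_ lt_u lt_w).
    by rewrite adj_sym (known_sym A_repr) (negPf nAwu) => /(_ wu).
  have u_range : b <= u < b + (14 - b).
    by rewrite subnKC ?le_bu // (leq_trans le_bu (ltnW lt_u)).
  have [//|u_cand|[k /andP[lt_ku k_twin] k_cand]] :=
      candidatesP (kept := [::]) _ u_range nAwu u_full.
    exact: (branch f u).
  have lt_k := ltn_trans lt_ku lt_u.
  have [f'_lab A_repr'] := represents_swap f_lab A_repr k_twin lt_u lt_k.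
  have nAwk := candidates_unknown k_cand.
  have f'w : (f \o swap u k) w = f w.
    rewrite /= /swap ifN; last by apply: contraNneq nAwk => <-; apply: (known_diag A_repr).
    by rewrite ifN //; apply: contraNneq nAwu => <-; apply: (known_diag A_repr).
  apply: (branch (f \o swap u k) k) => //; rewrite f'w.
    by rewrite /= /swap eqxx.
  move=> j lt_jk; rewrite /= /swap (ltn_eqF lt_jk) (ltn_eqF (ltn_trans lt_jk lt_ku)).
  exact/w_u/(ltn_trans lt_jk).
case: ifP => [_|/negbT v_short]; last exact: extendP.
case def_ws: [seq w <- order | ~~ full A w] => [|w ws]; first exact: (leaf_sound f_lab).
have : w \in [seq w <- order | ~~ full A w] by rewrite def_ws mem_head.
by rewrite mem_filter => /andP[w_short /order_lt lt_w]; apply: extendP.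
Qed.
End Labellings.

(** * The three starting points *)

Section Cases.
Variable G : sgraph.
Hypothesis G_connected : connected G.
Hypothesis G_cubic : cubic G.
Hypothesis G_order : #|G| = 14.
Hypothesis no_dominating4 : forall S : {set G}, dominating S -> 4 < #|S|.

(** Labelling a list of distinct vertices extends to all of G. *)
Lemma start_represents x0 (l : seq G) es : uniq l -> size l <= 14 ->
    all (fun e => [&& e.1 < size l, e.2 < size l & adj (nth x0 l e.1) (nth x0 l e.2)]) es ->
  exists f : nat -> G, labelling f /\ represents f (start es).
Proof.
move=> l_uniq l_size /allP es_l; pose l' := l ++ [seq x <- enum G | x \notin l].
have l'_uniq : uniq l'.
  rewrite cat_uniq l_uniq filter_uniq ?enum_uniq // andbT.
  by apply/hasPn => x; rewrite mem_filter => /andP[].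
have l'_size : size l' = 14.
  rewrite -(card_uniqP l'_uniq) -G_order; apply: eq_card => x.
  by rewrite mem_cat mem_filter mem_enum andbT orbN.
exists (nth x0 l'); split=> [i j lt_i lt_j /eqP|].
  by rewrite nth_uniq ?l'_size // => /eqP.
have es_adj u v : (u, v) \in es -> [&& u < 14, v < 14 & adj (nth x0 l' u) (nth x0 l' v)].
  move=> /es_l/and3P[/= lt_u lt_v uv].
  by rewrite !nth_cat lt_u lt_v uv !(leq_trans _ l_size).
split=> [|i lt_i|i j]; first exact: start_sym.
  by rewrite known_start eqxx lt_i.
rewrite known_start inE.
case/or3P=> [/andP[/eqP-> ->]|/es_adj/and3P[-> _ ->]|/es_adj/and3P[_ -> ji]].
- by rewrite eqxx.
- by rewrite orbT.
by rewrite adj_sym ji orbT.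
Qed.

(** The fuel 16 suffices for the lists used below: at least 6 of the 21 edges are
    given at the start, and one level is spent on the complete matrix. *)
Lemma search_from m order es x0 (l : seq G) :
    (forall a b c : G, #|union3 a b c| < m) -> all (gtn 14) order ->
    search m order 16 (start es) 0 0 -> uniq l -> size l <= 14 ->
    all (fun e => [&& e.1 < size l, e.2 < size l & adj (nth x0 l e.1) (nth x0 l e.2)]) es ->
  is_target G.
Proof.
move=> small order_lt found l_uniq l_size es_l.
have [f [f_lab f_repr]] := start_represents l_uniq l_size es_l.
exact: (search_sound G_cubic G_order no_dominating4 small G_connected order_lt
  f_lab f_repr _ _ found).
Qed.

Lemma neighbours_with (v x : G) : adj v x ->
  exists y z, uniq [:: v; x; y; z] /\ forall u, adj v u = (u \in [:: x; y; z]).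
Proof.
move=> vx; have := G_cubic v; rewrite (cardsD1 x) inE vx => -[]; rewrite cardE.
set s := enum _; have s_uniq : uniq s by apply: enum_uniq.
have mem_s u : (u \in s) = (u != x) && adj v u by rewrite mem_enum !inE.
case: s s_uniq mem_s => [|y [|z []]] // s_uniq mem_s _; exists y, z; split=> [|u].
  rewrite 2!cons_uniq s_uniq in_cons !mem_s eqxx adj_irrefl andbF orbF /= andbT.
  by apply: contraTneq vx => ->; rewrite adj_irrefl.
by rewrite inE mem_s; case: eqP => [->|].
Qed.

Lemma neighbours (v : G) :
  exists x y z, uniq [:: v; x; y; z] /\ forall u, adj v u = (u \in [:: x; y; z]).
Proof.
have /card_gt0P[x] : 0 < #|[set u | adj v u]| by rewrite G_cubic.
by rewrite inE => /neighbours_with[y [z]]; exists x, y, z.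
Qed.

(** Distinctness of the listed vertices comes for free from a large union. *)
Lemma uniq_of_union3 (a b c : G) (l : seq G) : {subset union3 a b c <= l} ->
  size l <= #|union3 a b c| -> uniq l.
Proof.
move=> sub_l le_l; apply/card_uniqP/eqP; rewrite eqn_leq card_size.
by rewrite (leq_trans le_l) //; apply/subset_leq_card/subsetP.
Qed.

Lemma union3_le12 (a b c : G) : #|union3 a b c| <= 12.
Proof.
rewrite (leq_trans (leq_card_setU _ _)) // card_closed_nbhd // -[12]/(8 + 4) leq_add2r.
by rewrite (leq_trans (leq_card_setU _ _)) // !card_closed_nbhd.
Qed.

(** The labels 0, 4 and 8 are the three centres, each followed by its neighbours.
   In the order of completion, labels without any known edge come first: their
   neighbourhoods are the least determined, and completing them early produces
   dominating sets or large unions high up in the tree. *)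
Definition disjoint_edges :=
  [:: (0, 1); (0, 2); (0, 3); (4, 5); (4, 6); (4, 7); (8, 9); (8, 10); (8, 11)].
Definition disjoint_order := [:: 12; 13; 11; 10; 9; 7; 6; 5; 3; 2; 1].

(** The common neighbour of the centres 0 and 8 is 1. *)
Definition linked_edges :=
  [:: (0, 1); (0, 2); (0, 3); (4, 5); (4, 6); (4, 7); (8, 1); (8, 9); (8, 10)].
Definition linked_order := [:: 11; 12; 13; 5; 6; 7; 1; 2; 3; 9; 10].

Definition pair_edges := [:: (0, 1); (0, 2); (0, 3); (4, 5); (4, 6); (4, 7)].
Definition pair_order := [:: 8; 9; 10; 11; 12; 13].

(** Unions of three closed neighbourhoods have at most 12 elements, so the bound
   13 closes no branch. *)
Lemma disjoint_search : search 13 disjoint_order 16 (start disjoint_edges) 0 0.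
Proof. vm_cast_no_check (erefl true). Qed.

Lemma linked_search : search 12 linked_order 16 (start linked_edges) 0 0.
Proof. vm_cast_no_check (erefl true). Qed.

Lemma pair_search : search 11 pair_order 16 (start pair_edges) 0 0.
Proof. vm_cast_no_check (erefl true). Qed.

Lemma target_of_disjoint_triple (a b c : G) : 12 <= #|union3 a b c| -> is_target G.
Proof.
move=> disj.
have [a1 [a2 [a3 [_ Na]]]] := neighbours a.
have [b1 [b2 [b3 [_ Nb]]]] := neighbours b.
have [c1 [c2 [c3 [_ Nc]]]] := neighbours c.
apply: (@search_from 13 disjoint_order disjoint_edges a
  [:: a; a1; a2; a3; b; b1; b2; b3; c; c1; c2; c3] _ isT disjoint_search) => //.
- by move=> x y z; rewrite ltnS union3_le12.
- apply: (@uniq_of_union3 a b c) => // u; rewrite !inE Na Nb Nc !inE -!orbA.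
  by do 11?[case/orP; first by move->; rewrite ?orbT] => ->; rewrite ?orbT.
by rewrite /= !Na !Nb !Nc !inE !eqxx ?orbT.
Qed.

(** The centres [a] and [c] are distinct and not adjacent, since otherwise the
    union would have at most 10 elements. So [x] is a common neighbour, and
    listing it once leaves exactly 11 vertices, which are therefore distinct. *)
Lemma target_of_linked_triple (a b c x : G) : (forall a b c : G, #|union3 a b c| < 12) ->
  11 <= #|union3 a b c| -> x \in closed_nbhd a -> x \in closed_nbhd c -> is_target G.
Proof.
move=> small large xa xc.
have [b1 [b2 [b3 [_ Nb]]]] := neighbours b.
have ne_ac : a != c.
  apply: contraTneq large => <-; rewrite -ltnNge /union3 setUAC setUid.
  by rewrite ltnS (leq_trans (leq_card_setU _ _)) // !card_closed_nbhd.
have nac : ~~ adj a c.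
  apply/negP => ac; have ca : adj c a by rewrite adj_sym.
  have [a2 [a3 [_ Na]]] := neighbours_with ac.
  have [c2 [c3 [_ Nc]]] := neighbours_with ca.
  suff : #|union3 a b c| <= size [:: a; c; a2; a3; b; b1; b2; b3; c2; c3].
    by rewrite leqNgt large.
  apply: leq_trans (card_size _); apply/subset_leq_card/subsetP => u.
  rewrite !inE Na Nb Nc !inE -!orbA.
  by do 11?[case/orP; first by move->; rewrite ?orbT] => ->; rewrite ?orbT.
have ax : adj a x.
  move: xa xc; rewrite !inE => /predU1P[->|//]; rewrite (negPf ne_ac) adj_sym.
  by rewrite (negPf nac).
have cx : adj c x.
  by move: xc; rewrite inE => /predU1P[eq_xc|//]; rewrite -eq_xc ax in nac.
have [a2 [a3 [_ Na]]] := neighbours_with ax.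
have [c2 [c3 [_ Nc]]] := neighbours_with cx.
apply: (@search_from 12 linked_order linked_edges a
  [:: a; x; a2; a3; b; b1; b2; b3; c; c2; c3] _ isT linked_search) => //.
- apply: (@uniq_of_union3 a b c) => // u; rewrite !inE Na Nb Nc !inE -!orbA.
  by do 11?[case/orP; first by move->; rewrite ?orbT] => ->; rewrite ?orbT.
by rewrite /= !Na !Nb !Nc !inE !eqxx ?orbT.
Qed.

(** The list [near] is the ball of radius 2 around [a]. *)
Lemma target_of_small_unions : (forall a b c : G, #|union3 a b c| < 11) -> is_target G.
Proof.
move=> small.
have /card_gt0P[a _] : 0 < #|G| by rewrite G_order.
have [a1 [a2 [a3 [a_uniq Na]]]] := neighbours a.
have second x : x \in [:: a1; a2; a3] ->
    exists y z, forall u, adj x u = (u \in [:: a; y; z]).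
  rewrite -Na adj_sym => /neighbours_with[y [z [_ Nx]]].
  by exists y, z.
have [|y1 [z1 N1]] := second a1; first by rewrite !inE eqxx ?orbT.
have [|y2 [z2 N2]] := second a2; first by rewrite !inE eqxx ?orbT.
have [|y3 [z3 N3]] := second a3; first by rewrite !inE eqxx ?orbT.
pose near := [:: a; a1; a2; a3; y1; z1; y2; z2; y3; z3].
have [b] : exists b, b \notin near.
  apply/existsP; rewrite -negb_forall; apply/negP => /forallP near_all.
  have: #|G| <= size near.
    apply: leq_trans (card_size near); apply/subset_leq_card/subsetP => u _.
    exact: near_all.
  by rewrite G_order.
move=> b_far.
have [b1 [b2 [b3 [b_uniq Nb]]]] := neighbours b.
apply: (@search_from 11 pair_order pair_edges a
  [:: a; a1; a2; a3; b; b1; b2; b3] _ isT pair_search) => //.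
  rewrite (cat_uniq [:: a; a1; a2; a3]); apply/and3P; split=> //.
  apply/hasPn => u; rewrite in_cons -Nb adj_sym eq_sym => b_u.
  apply: contra b_far => u_a; rewrite /near !inE.
  move: u_a b_u; rewrite !inE => /or4P[] /eqP->; rewrite ?Na ?N1 ?N2 ?N3 !inE;
    by do 3?[case/orP; first by move->; rewrite ?orbT] => ->; rewrite ?orbT.
by rewrite /= !Na !Nb !inE !eqxx ?orbT.
Qed.

Lemma target_of_no_dominating4 : is_target G.
Proof.
have [/existsP[a /existsP[b /existsP[c]]]|] :=
  boolP [exists a : G, exists b : G, exists c : G, 12 <= #|union3 a b c|].
  exact: target_of_disjoint_triple.
move=> no12; have small12 (a b c : G) : #|union3 a b c| < 12.
  rewrite ltnNge; apply: contra no12 => le12.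
  by apply/existsP; exists a; apply/existsP; exists b; apply/existsP; exists c.
have [/existsP[a /existsP[b /existsP[c le11]]]|no11] :=
  boolP [exists a : G, exists b : G, exists c : G, 11 <= #|union3 a b c|]; last first.
  apply: target_of_small_unions => a b c; rewrite ltnNge; apply: contra no11 => le11.
  by apply/existsP; exists a; apply/existsP; exists b; apply/existsP; exists c.
have [disj_ab|/set0Pn[x]] := eqVneq (closed_nbhd a :&: closed_nbhd b) set0; last first.
  rewrite inE => /andP[xa xb]; apply: (@target_of_linked_triple a c b x) => //.
  by rewrite /union3 setUAC.
have [disj_abc|/set0Pn[x]] :=
    eqVneq ((closed_nbhd a :|: closed_nbhd b) :&: closed_nbhd c) set0; last first.
  rewrite 2!inE => /andP[/orP[xa|xb] xc]; first exact: (@target_of_linked_triple a b c x).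
  by apply: (@target_of_linked_triple b a c x); rewrite // /union3 [_ :|: closed_nbhd a]setUC.
by have := small12 a b c; rewrite /union3 !cardsU disj_abc disj_ab !cards0 !card_closed_nbhd.
Qed.
End Cases.

Theorem theorem5p2 (G : sgraph) (G_connected : connected G) (G_cubic : cubic G)
    (G_order : #|G| = 14) (G_gamma : domination_number G = 5) :
  [\/ isomorphic G G14_1, isomorphic G G14_2, isomorphic G G14_3
    | isomorphic G P7_2].
Proof.
have no4 (S : {set G}) : dominating S -> 4 < #|S|.
  rewrite -G_gamma /domination_number; case: arg_minnP => [|S' _ S'_min]; last exact: S'_min.
  by apply/forallP => v; rewrite in_setT.
have [es] := target_of_no_dominating4 G_connected G_cubic G_order no4.
rewrite !inE => /or4P[] /eqP-> iso.
- exact: Or41.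
- exact: Or42.
- exact: Or43.
- exact: Or44.
Qed.
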